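(* Let $r \in \mathbb{N}$, $r \geq 1$, and let $\mathcal{S}^1 = \{\boldsymbol{x}_n\} \subset \mathbb{Z}^2$ be the circular path approximating, in the upper right quadrant, the circle $S^1 \subset \mathbb{R}^2$ of radius $r$ centred at the origin $\boldsymbol{o} = (0,0)$, i.e. the path obtained from the minimal-distance selection rule described in the context. Then $\mathcal{S}^1$ is a set of $2r$ points $\boldsymbol{x}_n = (x_n, y_n)$, with $x_n, y_n \in \mathbb{Z}$ and $0 \le n \le 2r-1$, and these coordinates obey the algebraic recursions $$x_0 = r, \qquad x_{n+1} = x_n + \tfrac{1}{2} s_n - \tfrac{1}{2},$$ $$y_0 = 0, \qquad y_{n+1} = y_n + \tfrac{1}{2} s_n + \tfrac{1}{2},$$ for all integers $n$ with $0 \le n \le 2r-1$, where $$s_n = -\operatorname{sgn}\left( a_n + \frac{r}{\sqrt{2}} \left( \sqrt{(a_n-1)^2 + c_n^2} - \sqrt{(a_n+1)^2 + c_n^2} \right) \right),$$ with $a_n = x_n + y_n$ and $c_n = r - n - 1$.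
   Context: The signum function is defined here by $\operatorname{sgn}(x) = -1$ if $x \le 0$ and $\operatorname{sgn}(x) = 1$ if $x > 0$ (so $\operatorname{sgn}(0) = -1$). The circular path $\mathcal{S}^1$ in the upper right quadrant, approximating the circle $S^1=\{(x,y)\in\mathbb{R}^2 : x^2+y^2=r^2\}$ of radius $r$ centred at the origin, is constructed as follows. The initial point is $\boldsymbol{x}_0 = (r, 0)$. Given a point $\boldsymbol{x}_n = (x_n, y_n)$ already on the path, there are two candidates for the next point, $$\boldsymbol{x}_{n+1}^{(1)} = (x_n - 1, y_n), \qquad \boldsymbol{x}_{n+1}^{(2)} = (x_n, y_n + 1).$$ Their Euclidean distances to $S^1$, measured along the line through the origin, are $$d_{n+1}^{(1)} = \left| r - \sqrt{(x_n - 1)^2 + y_n^2} \right|, \qquad d_{n+1}^{(2)} = \left| r - \sqrt{x_n^2 + (y_n + 1)^2} \right|.$$ The next point is the candidate with the smaller distance: $\boldsymbol{x}_{n+1} = \boldsymbol{x}_{n+1}^{(1)}$ if $d_{n+1}^{(1)} \le d_{n+1}^{(2)}$, and $\boldsymbol{x}_{n+1} = \boldsymbol{x}_{n+1}^{(2)}$ if $d_{n+1}^{(1)} > d_{n+1}^{(2)}$. The rule is applied for $n = 0, 1, \dots, 2r-1$. The points of the path $\mathcal{S}^1$ are $\boldsymbol{x}_0, \dots, \boldsymbol{x}_{2r-1}$; the last application of the rule gives the endpoint $\boldsymbol{x}_{2r}$ of the quarter circle, which is not counted among the $2r$ points. *)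

(* Defs.v *)
From mathcomp Require Import all_boot all_order all_algebra.
From mathcomp Require Import all_classical all_reals.
Set Implicit Arguments.
Unset Strict Implicit.
Unset Printing Implicit Defensive.
Import Order.TTheory GRing.Theory Num.Theory.
Local Open Scope ring_scope.
Local Open Scope classical_set_scope.

(* This differs from [Num.sg] at 0: here sgn 0 = -1. *)
Definition sgn (R : realType) (x : R) : R := if 0 < x then 1 else -1.

(* Distance from p to the circle of radius r centred at the origin, measured
   along the line through the origin and p. *)
Definition circle_dist (R : realType) (r : R) (p : R * R) : R :=
  `|r - Num.sqrt (p.1 ^+ 2 + p.2 ^+ 2)|.

Definition left_candidate (R : realType) (p : R * R) : R * R := (p.1 - 1, p.2).

Definition up_candidate (R : realType) (p : R * R) : R * R := (p.1, p.2 + 1).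

Definition next_point (R : realType) (r : R) (p : R * R) : R * R :=
  if circle_dist r (left_candidate p) <= circle_dist r (up_candidate p)
  then left_candidate p else up_candidate p.

(* The selection rule is iterated for every n; only the points with n <= 2r
   belong to the quarter circle and its endpoint. *)
Fixpoint path_point (R : realType) (r n : nat) : R * R :=
  if n is m.+1 then next_point r%:R (path_point R r m) else (r%:R, 0).

Definition path_x (R : realType) (r n : nat) : R := (path_point R r n).1.

Definition path_y (R : realType) (r n : nat) : R := (path_point R r n).2.

(* The endpoint with index 2r is not counted. *)
Definition circular_path (R : realType) (r : nat) : set (R * R) :=
  [set path_point R r n | n in `I_(2 * r)%N].
Arguments circular_path : clear implicits.

Definition path_a (R : realType) (r n : nat) : R := path_x R r n + path_y R r n.

Definition path_c (R : realType) (r n : nat) : R := r%:R - n%:R - 1.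

Definition path_s (R : realType) (r n : nat) : R :=
  let a := path_a R r n in
  let c := path_c R r n in
  - sgn (a + r%:R / Num.sqrt 2
             * (Num.sqrt ((a - 1) ^+ 2 + c ^+ 2)
                - Num.sqrt ((a + 1) ^+ 2 + c ^+ 2))).

(* Main.v *)
Require Import Defs.
From mathcomp Require Import all_boot all_order all_algebra.
From mathcomp Require Import all_classical all_reals.
From mathcomp Require Import ring lra zify.
Import Order.TTheory GRing.Theory Num.Theory.
Local Open Scope ring_scope.
Local Open Scope classical_set_scope.

(** Write [L] and [U] for the norms of the left and up candidates of a point
    [(x, y)].  Since [U ^+ 2 - L ^+ 2 = 2 * (x + y)], squaring the comparison
    [`|r - L| <= `|r - U|] turns it into [0 <= x + y + r * (L - U)]: the
    selection rule reads off the sign of this margin ([left_closerE]).  Every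
    step raises [y - x] by one, so [x - y = r - n] along the path; in the rotated
    coordinates [x + y] and [x - y] the norms become the square roots of the
    recursion, up to the factor [sqrt 2], and the argument of [sgn] in [path_s]
    is exactly the margin ([path_s_margin]).

    The rule goes left on a zero margin whereas [sgn 0 = -1] makes the recursion
    go up, so the content of the theorem is that ties never occur.  A tie with
    [x + y != 0] forces [2 * r * U = 2 * r ^+ 2 + (x + y)]; then [U] is a rational
    number with an integral square, hence an integer, [x + y = 2 * r * k] for some
    [k], and the norm equation becomes
    [(2 * r ^+ 2 - 1) * (2 * k ^+ 2 - 1) + (x - y - 1) ^+ 2 = 0], which is absurd
    ([up_norm_neq_tie]).

    It remains to see that [x + y] stays positive before the endpoint
    ([path_sum_gt0]).  Only a left step from the line [x + y = 1] could break
    this, and there both candidates are so close to the origin that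
    [L + U <= 2 * r], which makes the margin nonpositive and the step go up.
    Distinctness of the points follows from [y - x = n - r]. *)

(** The left side is [(2 * r * U) ^+ 2], with [U] the norm of the up candidate of
    [(x, y)]; equality would hold at a tie. *)
Lemma up_norm_neq_tie (r x y : int) : 0 < r -> x + y != 0 ->
  (2 * r) ^+ 2 * (x ^+ 2 + (y + 1) ^+ 2) != (2 * r ^+ 2 + (x + y)) ^+ 2.
Proof.
have sqr_gt0 (u : int) : u != 0 -> 0 < 2 * u ^+ 2 - 1.
  move=> u_neq0; have : 0 < u ^+ 2 by rewrite exprn_even_gt0.
  by lia.
move=> r_gt0 a_neq0; apply/eqP => tie.
have /dvdzP[m sumE] : (2 * r %| 2 * r ^+ 2 + (x + y))%Z.
  have : ((2 * r) ^+ 2 %| (2 * r ^+ 2 + (x + y)) ^+ 2)%Z.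
    by rewrite -tie dvdz_mulr.
  by rewrite !dvdzE !abszX dvdn_pexp2r.
pose k := m - r; have ak : x + y = k * (2 * r) by rewrite /k; lia.
have k_neq0 : k != 0 by apply: contraNneq a_neq0 => k0; rewrite ak k0 mul0r.
have normE : x ^+ 2 + (y + 1) ^+ 2 = (r + k) ^+ 2.
  apply: (@mulfI _ ((2 * r) ^+ 2)); first by rewrite expf_neq0 //; lia.
  by rewrite tie ak; ring.
have xE : x = k * (2 * r) - y by lia.
have sum0 :
    (2 * r ^+ 2 - 1) * (2 * k ^+ 2 - 1) + (x - y - 1) ^+ 2 = 0 :> int.
  apply: (@etrans _ _ (2 * (x ^+ 2 + (y + 1) ^+ 2) - 2 * (r + k) ^+ 2)).
    by rewrite xE; ring.
  by rewrite normE subrr.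
suff : 0 < (2 * r ^+ 2 - 1) * (2 * k ^+ 2 - 1) + (x - y - 1) ^+ 2.
  by rewrite sum0 ltxx.
by rewrite ltr_wpDr ?sqr_ge0 // mulr_gt0 // sqr_gt0 // lt0r_neq0.
Qed.

Definition norm2 {R : realType} (p : R * R) : R :=
  Num.sqrt (p.1 ^+ 2 + p.2 ^+ 2).

Definition margin {R : realType} (r : R) (p : R * R) : R :=
  p.1 + p.2 + r * (norm2 (left_candidate p) - norm2 (up_candidate p)).

Lemma sqr_norm2 (R : realType) (p : R * R) :
  norm2 p ^+ 2 = p.1 ^+ 2 + p.2 ^+ 2.
Proof. by rewrite sqr_sqrtr // addr_ge0 ?sqr_ge0. Qed.

Lemma norm2_ge0 (R : realType) (p : R * R) : 0 <= norm2 p.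
Proof. exact: sqrtr_ge0. Qed.

Lemma sqr_norm2_candidates (R : realType) (p : R * R) :
  norm2 (up_candidate p) ^+ 2 - norm2 (left_candidate p) ^+ 2
  = 2 * (p.1 + p.2).
Proof. by rewrite !sqr_norm2 /=; ring. Qed.

(** The difference of the squared distances is twice the margin. *)
Lemma left_closerE (R : realType) (r : R) (p : R * R) :
  (circle_dist r (left_candidate p) <= circle_dist r (up_candidate p))
  = (0 <= margin r p).
Proof.
rewrite /circle_dist -!/(norm2 _) -ler_sqr ?nnegrE ?normr_ge0 //.
rewrite !real_normK ?num_real // /margin.
have := sqr_norm2_candidates _ p.
set U := norm2 (up_candidate p); set L := norm2 (left_candidate p) => UL.
by apply/idP/idP => ?; nra.
Qed.

Lemma margin_lattice_neq0 (R : realType) (r x y : int) : 0 < r -> x + y != 0 ->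
  margin r%:~R (x%:~R, y%:~R) != 0 :> R.
Proof.
move=> r_gt0 a_neq0; apply/eqP; rewrite /margin /=.
have := sqr_norm2_candidates R (x%:~R, y%:~R).
have := sqr_norm2 R (up_candidate (x%:~R, y%:~R)).
set U := norm2 (up_candidate _); set L := norm2 (left_candidate _) => /=.
move=> U2 UL m0.
have a_neq0' : x%:~R + y%:~R != 0 :> R by rewrite -intrD intr_eq0.
have LU : U - L != 0.
  apply: contraNneq a_neq0' => /eqP; rewrite subr_eq0 => /eqP UL_eq.
  by apply/eqP; nra.
have sumE : U + L = 2 * r%:~R by apply: (mulfI LU); nra.
have UE : 2 * r%:~R * U = 2 * r%:~R ^+ 2 + (x%:~R + y%:~R) :> R by nra.
have /negP := up_norm_neq_tie r x y r_gt0 a_neq0; apply.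
rewrite -(eqr_int R) !(intrM, intrD, rmorphXn) /=; apply/eqP.
by rewrite -UE -U2; ring.
Qed.

(** On the line [x + y = 1] the squared norms of the candidates are [c ^+ 2 / 2]
    and [2 + c ^+ 2 / 2] with [c = x - y - 1].  For [`|c| <= r - 1] the norms
    are at most [r - 1] and [r + 1]; their sum is at most [2 * r], so the left
    candidate is at least as far inside the circle as the up candidate is on
    either side of it. *)
Lemma margin_le0 (R : realType) (r : R) (p : R * R) :
  p.1 + p.2 = 1 -> `|p.1 - p.2 - 1| <= r - 1 -> margin r p <= 0.
Proof.
move=> sum1 hc.
have := sqr_norm2_candidates R p; rewrite /margin sum1.
have := norm2_ge0 R (up_candidate p); have := norm2_ge0 R (left_candidate p).
have := sqr_norm2 R (up_candidate p); have := sqr_norm2 R (left_candidate p).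
set U := norm2 (up_candidate _); set L := norm2 (left_candidate _) => /=.
move=> L2 U2 L0 U0 UL.
have r1 : 0 <= r - 1 := le_trans (normr_ge0 _) hc.
have c2 : (p.1 - p.2 - 1) ^+ 2 <= (r - 1) ^+ 2.
  by rewrite -(real_normK (num_real _)) ler_sqr ?nnegrE.
have xE : p.1 = 1 - p.2 by lra.
have Lr : L <= r - 1.
  by rewrite -ler_sqr ?nnegrE // L2; move: c2; rewrite xE; nra.
have Ur : U <= r + 1.
  rewrite -ler_sqr ?nnegrE //; last by lra.
  by rewrite U2; move: c2; rewrite xE; nra.
have LU : 0 <= U - L by nra.
have : (U - L) * (U + L) <= (U - L) * (2 * r).
  by apply: ler_wpM2l => //; lra.
by nra.
Qed.

Lemma next_point_margin (R : realType) (r : R) (p : R * R) :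
  margin r p != 0 ->
  next_point r p = if 0 < margin r p then left_candidate p else up_candidate p.
Proof. by move=> m0; rewrite /next_point left_closerE le0r (negPf m0). Qed.

Lemma path_lattice (R : realType) (r n : nat) :
  exists x y : int,
    path_point R r n = (x%:~R, y%:~R) /\ x - y = r%:Z - n%:Z.
Proof.
elim: n => [|n [x [y [pE xyE]]]]; first by exists r%:Z, 0; rewrite !subr0.
rewrite /= pE /next_point; case: ifP => _.
  by exists (x - 1), y; split; [rewrite /left_candidate /= intrB | lia].
by exists x, (y + 1); split; [rewrite /up_candidate /= intrD | lia].
Qed.

Lemma path_subE (R : realType) (r n : nat) :
  path_x R r n - path_y R r n = r%:R - n%:R.
Proof.
have [x [y [pE xyE]]] := path_lattice R r n.
by rewrite /path_x /path_y pE /= -intrB xyE intrB.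
Qed.

Lemma path_point_inj (R : realType) (r : nat) : injective (path_point R r).
Proof.
move=> m n mn; have := path_subE R r m; rewrite /path_x /path_y mn.
rewrite -/(path_x R r n) -/(path_y R r n) path_subE => /addrI/oppr_inj/eqP.
by rewrite eqr_nat => /eqP.
Qed.

Lemma path_sum_gt0 (R : realType) (r n : nat) :
  (n < 2 * r)%N -> 0 < path_x R r n + path_y R r n.
Proof.
elim: n => [|n IH] nr; first by rewrite /path_x /path_y /= addr0 ltr0n; lia.
have := IH (ltnW nr).
have [x [y [pE xyE]]] := path_lattice R r n.
rewrite /path_x /path_y /= pE /= -intrD ltr0z => sum_gt0.
have r_gt0 : 0 < r%:Z by lia.
have m0 : margin r%:R (x%:~R, y%:~R) != 0 :> R.
  by apply: (margin_lattice_neq0 R r%:Z) => //; lia.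
rewrite next_point_margin //; case: ifPn => [m_gt0|_]; last first.
  by rewrite /= -(intrD _ y 1) -intrD ltr0z; lia.
rewrite /= -(intrB _ x 1) -intrD ltr0z.
have [sum1|sum_neq1] := eqVneq (x + y) 1; last by lia.
suff : margin r%:R (x%:~R, y%:~R) <= 0 :> R by rewrite leNgt m_gt0.
apply: margin_le0; first by rewrite /= -intrD sum1.
rewrite /= -intrB -(intrB _ _ 1) -intr_norm -(intrB _ r%:Z 1) ler_int xyE.
(* The step leads to an index before the endpoint, so that
   [1 - r <= r - n - 1 <= r - 1]. *)
by lia.
Qed.

Lemma path_margin_neq0 (R : realType) (r n : nat) :
  (n < 2 * r)%N -> margin r%:R (path_point R r n) != 0.
Proof.
move=> nr; have := path_sum_gt0 R r n nr.
have [x [y [pE _]]] := path_lattice R r n.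
rewrite /path_x /path_y pE /= -intrD ltr0z => sum_gt0.
by apply: (margin_lattice_neq0 R r%:Z) => //; lia.
Qed.

(** Rotating by 45 degrees: [(u + v) ^+ 2 + (u - v) ^+ 2] is twice the squared
    norm of [(u, v)], and both candidates share the difference [path_c]. *)
Lemma path_s_margin (R : realType) (r n : nat) :
  path_s R r n = - sgn (margin r%:R (path_point R r n)).
Proof.
rewrite /path_s /path_c -path_subE /path_a /path_x /path_y.
case: (path_point R r n) => x y /=; congr (- sgn _).
have rotate (u v : R) :
    Num.sqrt ((u + v) ^+ 2 + (u - v) ^+ 2) = Num.sqrt 2 * norm2 (u, v).
  by rewrite -sqrtrM //; congr Num.sqrt; rewrite /=; ring.
have -> : (x + y - 1) ^+ 2 + (x - y - 1) ^+ 2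
    = (x - 1 + y) ^+ 2 + (x - 1 - y) ^+ 2 by ring.
have -> : (x + y + 1) ^+ 2 + (x - y - 1) ^+ 2
    = (x + (y + 1)) ^+ 2 + (x - (y + 1)) ^+ 2 by ring.
rewrite !rotate -mulrBr mulrA divfK // gt_eqF // sqrtr_gt0 ltr0n //.
Qed.

Theorem proposition2p1 (R : realType) (r : nat) (hr : (1 <= r)%N) :
  [/\ (circular_path R r #= `I_(2 * r)%N)%card,
      forall n : nat, (n <= 2 * r - 1)%N ->
        path_x R r n \is a Num.int /\ path_y R r n \is a Num.int,
      path_x R r 0 = r%:R,
      path_y R r 0 = 0
    & forall n : nat, (n <= 2 * r - 1)%N ->
        path_x R r n.+1 = path_x R r n + 1 / 2 * path_s R r n - 1 / 2 /\
        path_y R r n.+1 = path_y R r n + 1 / 2 * path_s R r n + 1 / 2].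
Proof.
split=> //.
- by apply: inj_card_eq => m n _ _; exact: path_point_inj.
- move=> n _; have [x [y [pE _]]] := path_lattice R r n.
  by rewrite /path_x /path_y pE !intr_int.
move=> n nr; have {}nr : (n < 2 * r)%N by lia.
rewrite path_s_margin /sgn /path_x /path_y /=.
rewrite next_point_margin ?path_margin_neq0 //.
by case: ifP => _ /=; split; lra.
Qed.
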